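(* If $H$ is a graph with $n$ vertices, chromatic number $q$, and maximum degree $d \geq 2$, then for every $2$-edge-coloring of $K_N$ with $N \geq 2^{(2d+2)(2q-3)+2}n$, there are at least $\left(2^{-(2d+2)(2q-3)-2}N\right)^n$ labeled monochromatic copies of $H$.
   Context: A labeled copy of $H$ in $K_N$ is an injective map from the vertex set of $H$ to the vertex set of $K_N$; it is monochromatic if all images of edges of $H$ receive the same color. *)

(* Defs.v *)
From HB Require Import structures.
From mathcomp Require Import all_boot all_order all_algebra.

Set Implicit Arguments.
Unset Strict Implicit.
Unset Printing Implicit Defensive.

Record simple_graph (V : finType) := SimpleGraph {
  adj :> rel V;
  adj_sym : symmetric adj;
  adj_irr : irreflexive adj }.

Section Graph.
Variables (V : finType) (H : simple_graph V).

Definition degree (x : V) : nat := #|[set y | H x y]|.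

Definition max_degree : nat := \max_(x : V) degree x.

Definition proper_coloring (k : nat) (f : {ffun V -> 'I_k}) : bool :=
  [forall x, forall y, H x y ==> (f x != f y)].

Definition colorable (k : nat) : bool :=
  [exists f : {ffun V -> 'I_k}, proper_coloring f].

Lemma ex_colorable : exists k, colorable k.
Proof.
exists #|V|; apply/existsP; exists [ffun x => enum_rank x].
apply/forallP => x; apply/forallP => y; apply/implyP => xy.
rewrite !ffunE (inj_eq enum_rank_inj).
by apply/eqP => eq_xy; rewrite eq_xy adj_irr in xy.
Qed.

Definition chromatic_number : nat := ex_minn ex_colorable.

End Graph.

(* The diagonal values of [color] carry no information: [K_N] has no loops. *)
Record edge_2coloring (N : nat) := Edge2Coloring {
  color :> 'I_N -> 'I_N -> bool;
  color_sym : forall u v, color u v = color v u }.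

Section Copies.
Variables (V : finType) (H : simple_graph V).
Variables (N : nat) (c : edge_2coloring N).

Definition monochromatic (f : {ffun V -> 'I_N}) : bool :=
  [exists b : bool, forall x, forall y, H x y ==> (c (f x) (f y) == b)].

Definition mono_copies : {set {ffun V -> 'I_N}} :=
  [set f : {ffun V -> 'I_N} | injectiveb f & monochromatic f].

End Copies.

(* Main.v *)
Require Import Defs.
From HB Require Import structures.
From mathcomp Require Import all_boot all_order all_algebra.
From mathcomp Require Import ring lra zify.

Set Implicit Arguments.
Unset Strict Implicit.
Unset Printing Implicit Defensive.

Import Order.TTheory GRing.Theory Num.Theory.
Local Open Scope ring_scope.

(** Put m = N / 2^((2d+2)(2q-3)) = 4M. Starting from all N vertices, dependent
random choice with 2d sample points in the majority color keeps a
2^-(2d+2) proportion of the current set A and leaves fewer than (m/2d)^d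
d-tuples having less than m common neighbours in A. After 2q-3 steps some color
was used q-1 times, which gives nested sets B_0, ..., B_(q-1) of size at least m
for a single color. The q color classes of H are embedded greedily, the last one
first, class i into B_i, so that for every vertex still to come the embedded
neighbours have few extensions to a d-tuple with less than m common neighbours.
Then each vertex has at least m candidates, of which at most d * (m/2d) = 2M are
dangerous for its later neighbours and fewer than n <= M are already used, so
that M choices remain. *)

(** * Power means from tangent lines *)

Lemma exprn_tangent (R : realFieldType) (p y : R) k : 0 <= p -> 0 <= y ->
  p ^+ k.+1 + k.+1%:R * p ^+ k * (y - p) <= y ^+ k.+1.
Proof.
move=> p0 y0; elim: k => [|k IH]; first by rewrite !expr1 expr0; lra.
have := ler_wpM2l y0 IH; rewrite -exprS; apply: le_trans.
rewrite -subr_ge0.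
have -> : y * (p ^+ k.+1 + k.+1%:R * p ^+ k * (y - p)) -
   (p ^+ k.+2 + k.+2%:R * p ^+ k.+1 * (y - p)) = k.+1%:R * p ^+ k * (y - p) ^+ 2.
  by rewrite !exprS -[k.+2]addn1 natrD; ring.
by rewrite mulr_ge0 ?sqr_ge0 // mulr_ge0 ?exprn_ge0.
Qed.

(** Sum the tangent inequality at [p]: as [p] is at most the mean of [F] over [A], the linear terms
    have a nonnegative total. *)
Lemma exprn_power_mean (R : realFieldType) (I : finType) (A : {set I})
    (F : I -> R) (p : R) k :
  0 <= p -> (forall i, 0 <= F i) -> #|A|%:R * p <= \sum_(i in A) F i ->
  #|A|%:R * p ^+ k <= \sum_(i in A) F i ^+ k.
Proof.
move=> p0 F0 leF; case: k => [|k].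
  by under eq_bigr do rewrite expr0; rewrite sumr_const expr0 mulr1.
have leS : \sum_(i in A) (p ^+ k.+1 + k.+1%:R * p ^+ k * (F i - p)) <=
  \sum_(i in A) F i ^+ k.+1 by apply: ler_sum => i _; exact: exprn_tangent.
apply: le_trans leS; rewrite big_split /= sumr_const -[X in X <= _]addr0.
rewrite -[p ^+ _ *+ _]mulr_natl lerD2l -mulr_sumr sumrB sumr_const -[p *+ _]mulr_natl.
by rewrite mulr_ge0 ?subr_ge0 // mulr_ge0 ?exprn_ge0 ?ler0n.
Qed.

(** * Dependent random choice, with expectations written as sums over samples *)

Section DependentRandomChoice.
Variables (R : realFieldType) (T : finType).
Implicit Types (e : rel T) (A B : {set T}) (S : seq T) (m mu : R).

Definition common_nbhd e A S := [set y in A | all (e^~ y) S].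

Definition poor e A m S := #|common_nbhd e A S|%:R < m.

(* The number of [r]-tuples over [B] whose extension of [S] satisfies [bad]. *)
Fixpoint count_ext B (bad : pred (seq T)) r S : nat :=
  if r is r'.+1 then (\sum_(x in B) count_ext B bad r' (x :: S))%N else bad S.

Lemma count_ext_sub B (bad bad' : pred (seq T)) r S :
  subpred bad bad' -> (count_ext B bad r S <= count_ext B bad' r S)%N.
Proof.
move=> sub; elim: r S => [|r IH] S /=; last by apply: leq_sum => x _.
by case E: (bad S); rewrite // sub.
Qed.

Lemma poor_sub e A A' m : A \subset A' -> subpred (poor e A' m) (poor e A m).
Proof.
move=> sub S; apply: le_lt_trans; rewrite ler_nat; apply/subset_leq_card/subsetP.
by move=> x; rewrite !inE => /andP[/(subsetP sub) -> ->].
Qed.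

(** Markov's inequality: every heavy [x] contributes at least [mu ^+ r] to the count for [r.+1]. *)
Lemma card_heavy_ext B bad r S mu : 0 < mu ->
  (count_ext B bad r.+1 S)%:R < mu ^+ r.+1 ->
  #|[set x in B | mu ^+ r <= (count_ext B bad r (x :: S))%:R]|%:R <= mu.
Proof.
move=> mu0; set X := finset _ => lt_mu.
rewrite -(ler_pM2r (exprn_gt0 r mu0)) -exprS; apply: le_trans (ltW lt_mu).
rewrite mulr_natl -sumr_const /= natr_sum.
rewrite [leRHS](big_setID X) /= (setIidPr _); last first.
  by apply/subsetP => x; rewrite inE => /andP[].
rewrite ler_wpDr ?sumr_ge0 //; apply: ler_sum => x.
by rewrite inE => /andP[].
Qed.

(** At most [mu] points of [B] are heavy, so a light one can be prepended until [r] is 0, where a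
    count below 1 means that the tuple is not bad. *)
Lemma light_ext_exists B bad r S mu : 0 < mu -> mu < #|B|%:R ->
  (count_ext B bad r S)%:R < mu ^+ r -> exists S', ~~ bad (S' ++ S).
Proof.
move=> mu0 muB; elim: r S => [|r IH] S lt_mu.
  exists [::]; move: lt_mu; rewrite expr0 ltrn1 /=.
  by case: (bad S).
have := card_heavy_ext mu0 lt_mu; set X := finset _ => leX.
have /subsetPn[x xB] : ~~ (B \subset X).
  apply/negP => /subset_leq_card; rewrite -(ler_nat R) => leBX.
  by move: (lt_le_trans muB (le_trans leBX leX)); rewrite ltxx.
rewrite inE xB /= -ltNge => /IH[S' S'P].
by exists (rcons S' x); rewrite cat_rcons.
Qed.

Lemma common_nbhd_cat e A S S' :
  common_nbhd e A (S' ++ S) \subset common_nbhd e A S.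
Proof. by apply/subsetP => x; rewrite !inE all_cat => /and3P[-> _ ->]. Qed.

(** The random subset of [A]: [t] lists the [k] sample points, which the sums below draw from [A]
    with repetition. *)
Definition sample_nbhd e A k (t : {ffun 'I_k -> T}) :=
  [set x in A | [forall j, e x (t j)]].

Lemma card_sample_common e A k S :
  (#|[pred t : {ffun 'I_k -> T} | (t \in ffun_on (mem A)) &&
      all (mem (sample_nbhd e A t)) S]| <= #|common_nbhd e A S| ^ k)%N.
Proof.
have <- : #|ffun_on (mem (common_nbhd e A S)) : {pred {ffun 'I_k -> T}}| =
  (#|common_nbhd e A S| ^ k)%N by rewrite card_ffun_on card_ord.
apply/subset_leq_card/subsetP => t.
rewrite !inE => /andP[/ffun_onP tA /allP tS]; apply/ffun_onP => j.
rewrite inE tA; apply/allP => x /tS; rewrite !inE => /andP[_ /forallP]; exact.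
Qed.

Lemma sum_card_sample e A k :
  (\sum_(t in ffun_on (mem A)) #|@sample_nbhd e A k t| =
   \sum_(x in A) #|[set y in A | e x y]| ^ k)%N.
Proof.
under eq_bigr do rewrite -sum1_card.
rewrite (exchange_big_dep (mem A)) /=; last by move=> t x _; rewrite inE => /andP[].
apply: eq_bigr => x xA; rewrite sum1_card.
have <- : #|ffun_on (mem [set y in A | e x y]) : {pred {ffun 'I_k -> T}}| =
  (#|[set y in A | e x y]| ^ k)%N by rewrite card_ffun_on card_ord.
apply: eq_card => t; rewrite [LHS]unfold_in /= [x \in _]inE xA; apply/andP/ffun_onP.
  by move=> [/ffun_onP tA /forallP tx] j; rewrite inE tA tx.
move=> tP; split; first by apply/ffun_onP => j; have := tP j; rewrite inE => /andP[].
by apply/forallP => j; have := tP j; rewrite inE => /andP[].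
Qed.

Lemma sum_count_sample e A m k r S : 0 <= m ->
  \sum_(t : {ffun 'I_k -> T} | (t \in ffun_on (mem A)) &&
      all (mem (sample_nbhd e A t)) S)
    (count_ext (sample_nbhd e A t) (poor e A m) r S)%:R <= #|A|%:R ^+ r * m ^+ k.
Proof.
move=> m0; elim: r S => [|r IH] S.
  rewrite /= sumr_const expr0 mul1r.
  have [lt_m|] := boolP (poor e A m S); last by rewrite mul0rn exprn_ge0.
  apply: (@le_trans _ _ (#|common_nbhd e A S| ^ k)%:R).
    by rewrite ler_nat card_sample_common.
  by rewrite natrX lerXn2r ?nnegrE ?ler0n // ltW.
under eq_bigr do rewrite /= natr_sum.
rewrite (exchange_big_dep (mem A)) /=; last by move=> t x _; rewrite inE => /andP[].
rewrite exprS -mulrA mulr_natl -sumr_const; apply: ler_sum => x _.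
apply: le_trans (IH (x :: S)); rewrite le_eqVlt; apply/orP; left; apply/eqP.
by apply: eq_bigl => t /=; rewrite -andbA [_ && all _ _]andbC.
Qed.

(** By power means, the sampled set has average size at least [#|A|%:R / 4 ^+ d]. Sets smaller than
    a quarter of this and sets with too many poor tuples account for at most 1/4 + 1/2 of it, so
    some sample is good. *)
Lemma dependent_random_choice e A d m : (0 < d)%N -> 0 < m ->
  2 ^+ (2 * d + 2) * m <= #|A|%:R ->
  #|A|%:R ^+ 2 <= 2 * \sum_(x in A) #|[set y in A | e x y]|%:R :> R ->
  exists U : {set T}, [/\ U \subset A, #|A|%:R <= 2 ^+ (2 * d + 2) * #|U|%:R :> R
    & (count_ext U (poor e A m) d [::])%:R < (m / (2 * d)%:R) ^+ d].
Proof.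
move=> d0 m0 leA dense; set a : R := #|A|%:R in leA dense *.
set K : R := 2 ^+ _ in leA *; set beta := (_ / _) ^+ d.
have K0 : 0 < K by rewrite exprn_gt0.
have a0 : 0 < a by apply: lt_le_trans leA; rewrite mulr_gt0.
have dR0 : 0 < (2 * d)%:R :> R by rewrite ltr0n muln_gt0.
have beta0 : 0 < beta by rewrite exprn_gt0 // divr_gt0.
pose U (t : {ffun 'I_(2 * d) -> T}) := sample_nbhd e A t.
pose good t := (a <= K * #|U t|%:R) &&
  ((count_ext (U t) (poor e A m) d [::])%:R < beta).
have [/existsP[t /andP[tA tP]]|/existsPn nogood] :=
    boolP [exists t, (t \in ffun_on (mem A)) && good t].
  exists (U t); move: tP => /andP[-> ->]; split=> //.
  by apply/subsetP => x; rewrite inE => /andP[].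
exfalso.
(* A bad sample has either a small set, bounded by the first term, or a count of at least [beta],
   which makes the second term at least [a]. *)
have leU t : t \in ffun_on (mem A) ->
    #|U t|%:R <= a / K + a / beta * (count_ext (U t) (poor e A m) d [::])%:R.
  move=> tA; have := nogood t; rewrite tA /good /= negb_and -ltNge -leNgt.
  case/orP => [lt_a|le_b].
    apply: ler_wpDr; first by rewrite mulr_ge0 ?ler0n // ltW ?divr_gt0.
    by rewrite ler_pdivlMr // mulrC ltW.
  apply: ler_wpDl; first by rewrite divr_ge0 // ltW.
  apply: (@le_trans _ _ a).
    by rewrite ler_nat subset_leq_card //; apply/subsetP => x; rewrite inE => /andP[].
  by rewrite -mulrA ler_peMr ?(ltW a0) // mulrC ler_pdivlMr // mul1r.
have sumU : a * (a / 2) ^+ (2 * d) <= \sum_(t in ffun_on (mem A)) #|U t|%:R.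
  rewrite -natr_sum sum_card_sample natr_sum; under eq_bigr do rewrite natrX.
  apply: exprn_power_mean => //; first by rewrite divr_ge0 // ltW.
  by rewrite -/a; move: dense; rewrite expr2; lra.
have {leU}sumU' : \sum_(t in ffun_on (mem A)) #|U t|%:R <=
    a ^+ (2 * d) * (a / K) + a / beta * (a ^+ d * m ^+ (2 * d)).
  apply: (le_trans (ler_sum _ leU)); rewrite big_split /= sumr_const card_ffun_on.
  rewrite card_ord -mulr_natl natrX lerD2l -mulr_sumr ler_pM2l ?divr_gt0 //.
  apply: le_trans (@sum_count_sample e A m (2 * d) d [::] (ltW m0)).
  by under [leRHS]eq_bigl do rewrite andbT.
have := le_trans sumU sumU'.
have -> : a * (a / 2) ^+ (2 * d) = a * (a ^+ 2 / 4) ^+ d.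
  by rewrite exprM; congr (_ * _ ^+ _); field.
have KE : K = 4 * 4 ^+ d.
  by rewrite /K exprD exprM mulrC; congr (_ * _ ^+ d); rewrite expr2; ring.
have -> : a ^+ (2 * d) * (a / K) = a * ((a ^+ 2 / 4) ^+ d / 4).
  rewrite KE exprM expr_div_n; field.
  by rewrite expf_neq0 // pnatr_eq0.
have -> : a / beta * (a ^+ d * m ^+ (2 * d)) = a * (a * m * (2 * d)%:R) ^+ d.
  rewrite /beta exprM !exprMn exprVn; field.
  by rewrite !expf_neq0 // lt0r_neq0 //; move: dR0; rewrite natrM.
rewrite -mulrDr ler_pM2l //.
have d2 : (2 * d <= 2 ^ d)%N.
  by case: (d) d0 => // d' _; rewrite expnS leq_mul2l ltn_expl.
(* This amounts to [16 * d * m <= a], which follows from [K = 4 * 4 ^+ d] and [2 * d <= 2 ^ d]. *)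
have le1 : a * m * (2 * d)%:R <= a ^+ 2 / 4 * (1 / 2).
  have : (2 * d)%:R * (2 * d)%:R * m * 4 <= a.
    apply: le_trans leA; rewrite mulrAC ler_pM2r // KE mulrC ler_pM2l //.
    have -> : 4 ^+ d = 2 ^+ d * 2 ^+ d :> R.
      by rewrite -exprMn; congr (_ ^+ _); ring.
    by rewrite -natrX -!natrM ler_nat leq_mul.
  have dge : 2 <= (2 * d)%:R :> R by rewrite ler_nat leq_pmulr.
  set D : R := (2 * d)%:R in dge dR0 *.
  move=> le2.
  have : 2 * D * m * 4 <= a.
    apply: le_trans le2; rewrite ler_pM2r // ler_pM2r // ler_pM2r //.
  rewrite expr2; nra.
have x0 : 0 < (a ^+ 2 / 4) ^+ d by rewrite exprn_gt0 // divr_gt0 // exprn_gt0.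
have : (a * m * (2 * d)%:R) ^+ d <= (a ^+ 2 / 4) ^+ d * (1 / 2).
  apply: (@le_trans _ _ ((a ^+ 2 / 4 * (1 / 2)) ^+ d)).
    rewrite lerXn2r // nnegrE; first by rewrite !mulr_ge0 // ltW.
    by rewrite mulr_ge0 // divr_ge0 // exprn_ge0 // ltW.
  rewrite exprMn ler_pM2l // -[leRHS]expr1; apply: ler_wiXn2l => //; lra.
lra.
Qed.

End DependentRandomChoice.

(** * Nested sets for a single color *)

Section NestedSets.
Variables (R : realFieldType) (T : finType) (d : nat) (m : R).
Hypotheses (d_gt0 : (0 < d)%N) (m_gt0 : 0 < m).
Implicit Types (e : rel T) (A : {set T}) (B : nat -> {set T}).

(** The length [l] counts steps, so there are [l.+1] sets: one per color class of [H] when [l] is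
    [q.-1]. *)
Definition rich_chain e l (B : nat -> {set T}) :=
  (forall i, (i <= l)%N -> m <= #|B i|%:R) /\
  (forall i, (i < l)%N -> B i.+1 \subset B i /\
    (count_ext (B i.+1) (poor e (B i) m) d [::])%:R < (m / (2 * d)%:R) ^+ d).

Lemma rich_chain0 e A : m <= #|A|%:R -> rich_chain e 0 (fun=> A).
Proof. by move=> leA; split. Qed.

Lemma rich_chain_cons e l B A : B 0%N \subset A ->
  (count_ext (B 0%N) (poor e A m) d [::])%:R < (m / (2 * d)%:R) ^+ d ->
  rich_chain e l B -> rich_chain e l.+1 (fun i => if i is j.+1 then B j else A).
Proof.
move=> subA few [large nested]; split=> [[|i] //|[|i] //]; last exact: nested.
by move=> _; apply: le_trans (large 0%N _) _; rewrite // ler_nat subset_leq_card.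
by move=> il; apply: large.
Qed.

(** A step in the other color does not lengthen this chain; its first set is enlarged to [A], which
    can only make fewer tuples poor. *)
Lemma rich_chain_widen e l B A : B 0%N \subset A -> rich_chain e l B ->
  rich_chain e l (fun i => if i is _.+1 then B i else A).
Proof.
move=> subA [large nested]; split=> [[|i]|[|i]] il; try exact: large; try exact: nested.
  by apply: le_trans (large 0%N _) _; rewrite // ler_nat subset_leq_card.
have [sub few] := nested _ il; split; first exact: subset_trans subA.
by apply: le_lt_trans few; rewrite ler_nat; apply: count_ext_sub; exact: poor_sub.
Qed.

Variable c : T -> T -> bool.

(* Diagonal values are kept as loops, so that the density is exact; injective
copies never see them. *)
Let color_rel b : rel T := fun x y => c x y == b.

Lemma majority_color A : exists b,
  #|A|%:R ^+ 2 <= 2 * \sum_(x in A) #|[set y in A | color_rel b x y]|%:R :> R.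
Proof.
pose D b : R := \sum_(x in A) #|[set y in A | color_rel b x y]|%:R.
have sumD : D true + D false = #|A|%:R ^+ 2.
  rewrite /D -big_split /= expr2 mulr_natl -sumr_const; apply: eq_bigr => x _.
  rewrite -natrD -(cardsID [set y | c x y] A); congr (_ + _)%:R; apply: eq_card => y.
    by rewrite !inE /color_rel eqb_id.
  by rewrite !inE /color_rel eqbF_neg andbC.
by have [leD|ltD] := lerP (D false) (D true); [exists true|exists false]; rewrite -/(D _); lra.
Qed.

(** A Ramsey-type recursion: each step costs a factor [K] and lowers the demand of the majority
    color by one, so for positive [k] and [l] one demand is met after at most [(k + l).-1] steps. *)
Lemma monochromatic_chain k l A :
  (2 ^+ (2 * d + 2)) ^+ (k + l).-1 * m <= #|A|%:R ->
  exists b B, B 0%N = A /\ rich_chain (color_rel b) (if b then k else l) B.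
Proof.
set K : R := 2 ^+ _; have K1 : 1 <= K by rewrite exprn_ege1 // ler1n.
have K0 : 0 < K by apply: lt_le_trans K1.
move: {2}(k + l)%N (leqnn (k + l)) => n; elim: n => [|n IH] in k l A *.
  rewrite leqn0 addn_eq0 => /andP[/eqP-> /eqP->] /=; rewrite expr0 mul1r => leA.
  by exists true, (fun=> A); split=> //; exact: rich_chain0.
move=> kln leA.
have mA : m <= #|A|%:R.
  by apply: le_trans leA; rewrite ler_peMl ?(ltW m_gt0) // (exprn_ege1 _ K1).
case: k kln leA => [|k] kln leA.
  by exists true, (fun=> A); split=> //; exact: rich_chain0.
case: l kln leA => [|l] kln leA.
  by exists false, (fun=> A); split=> //; exact: rich_chain0.
have [b dense] := majority_color A.
have leKA : K * m <= #|A|%:R.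
  apply: le_trans leA; rewrite ler_pM2r // addSn addnS /= exprS.
  by rewrite ler_peMr ?(ltW K0) // (exprn_ege1 _ K1).
have [U [UA leU few]] := dependent_random_choice d_gt0 m_gt0 leKA dense.
have leU' : K ^+ (k + l) * m <= #|U|%:R.
  rewrite -(ler_pM2l K0) mulrA -exprS; apply: le_trans leU.
  by move: leA; rewrite addSn addnS.
case: b dense few => dense few.
  have [||b [B [B0 chB]]] := IH k l.+1 U; rewrite ?addnS //.
    by move: kln; rewrite addSn addnS.
  rewrite -B0 in UA few; case: b chB => chB.
    exists true, (fun i => if i is j.+1 then B j else A); split=> //.
    exact: rich_chain_cons.
  exists false, (fun i => if i is _.+1 then B i else A); split=> //.
  exact: rich_chain_widen.
have [||b [B [B0 chB]]] := IH k.+1 l U; rewrite ?addSn //.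
  by move: kln; rewrite addSn addnS.
rewrite -B0 in UA few; case: b chB => chB.
  exists true, (fun i => if i is _.+1 then B i else A); split=> //.
  exact: rich_chain_widen.
exists false, (fun i => if i is j.+1 then B j else A); split=> //.
exact: rich_chain_cons.
Qed.

End NestedSets.

(** * Counting maps one vertex at a time *)

Section Extension.
Variables (V T : finType).
Implicit Types (f : {ffun V -> T}) (s : seq V).

Definition upd f v x : {ffun V -> T} := [ffun u => if u == v then x else f u].

Lemma upd_out f v x s : v \notin s -> {in s, upd f v x =1 f}.
Proof. by move=> vs u us; rewrite ffunE; case: eqP vs => // <-; rewrite us. Qed.

Lemma card_extensions (R : realFieldType) (x0 : T) (M : R)
    (P : seq V -> pred {ffun V -> T}) (ok : pred (seq V)) :
  0 <= M -> P [::] [ffun=> x0] ->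
  (forall v s, ok (v :: s) -> ok s /\ v \notin s) ->
  (forall v s f, ok (v :: s) -> P s f -> M <= #|[set x | P (v :: s) (upd f v x)]|%:R) ->
  forall s, ok s -> M ^+ size s <= #|[set f | P s f]|%:R.
Proof.
move=> M0 P0 okP extP s oks.
(* Fixing the value [x0] outside [s] makes the pair of [f] and [x] recoverable from [upd f v x], so
   distinct choices give distinct maps. *)
suff : M ^+ size s <=
    #|[set f | P s f & [forall u, (u \notin s) ==> (f u == x0)]]|%:R.
  move=> /le_trans; apply; rewrite ler_nat; apply/subset_leq_card/subsetP => f.
  by rewrite !inE => /andP[].
elim: s oks => [|v s IH] oks.
  rewrite expr0 ler1n; apply/card_gt0P; exists [ffun=> x0]; rewrite inE P0.
  by apply/forallP => u; rewrite ffunE eqxx implybT.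
have [oks' vs] := okP _ _ oks; have {IH} := IH oks'.
set F := finset _; set F' := finset _ => leF.
pose D := [set p : {ffun V -> T} * T | (p.1 \in F) && P (v :: s) (upd p.1 v p.2)].
have cardD : M * #|F|%:R <= #|D|%:R.
  rewrite mulr_natr -sumr_const /=.
  have -> : #|D| = (\sum_(f in F) #|[set x | P (v :: s) (upd f v x)]|)%N.
    under eq_bigr do rewrite -sum1_card.
    rewrite pair_big_dep -sum1_card /=; apply: eq_bigl => p.
    by rewrite !inE.
  rewrite natr_sum; apply: ler_sum => f fF; apply: extP => //.
  by move: fF; rewrite inE => /andP[].
rewrite /= exprS; apply: (le_trans (ler_wpM2l M0 leF)); apply: (le_trans cardD).
have injD : {in D &, injective (fun p : {ffun V -> T} * T => upd p.1 v p.2)}.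
  move=> [f x] [g y]; rewrite !inE /= => /andP[/andP[_ /forallP f0] _].
  move=> /andP[/andP[_ /forallP g0] _] /ffunP eq_fg.
  have -> : x = y by have := eq_fg v; rewrite !ffunE eqxx.
  congr (_, _); apply/ffunP => u; have := eq_fg u; rewrite !ffunE; case: eqP => // -> _.
  by have := f0 v; have := g0 v; rewrite vs /= => /eqP -> /eqP.
rewrite -(card_in_imset injD) ler_nat; apply/subset_leq_card/subsetP => g.
case/imsetP=> [[f x]] fxD ->; move: fxD; rewrite !inE /=.
case/andP=> /andP[_ /forallP f0] Pfx.
rewrite Pfx; apply/forallP => u; rewrite inE negb_or ffunE; apply/implyP.
by case: eqP => //= _; apply/implyP.
Qed.

End Extension.

Lemma card_bigcup_le (I U : finType) (A : {set I}) (F : I -> {set U}) :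
  (#|\bigcup_(i in A) F i| <= \sum_(i in A) #|F i|)%N.
Proof.
elim/big_rec2: _ => [|i n X _ leX]; first by rewrite cards0.
by apply: leq_trans (leq_add (leqnn _) leX); rewrite leq_card_setU.
Qed.

(** * Greedy embedding, highest level first *)

Section GreedyEmbedding.
Variables (R : realFieldType) (V T : finType) (H : simple_graph V) (e : rel T).
Variables (d l : nat) (M : R) (B : nat -> {set T}) (lev : V -> nat).
Hypotheses (e_sym : symmetric e) (d_gt0 : (0 < d)%N) (M_gt0 : 0 < M).
Hypothesis M_ge : #|V|%:R <= M.
Hypothesis degH : forall v, (degree H v <= d)%N.
Hypothesis chB : rich_chain d (4 * M) e l B.
Hypothesis lev_le : forall v, (lev v <= l)%N.
Hypothesis lev_proper : forall u v, H u v -> lev u != lev v.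

Let mu : R := 4 * M / (2 * d)%:R.

Definition upper_nbrs s v := [seq u <- s | H v u & (lev v < lev u)%N].

(* In every use [r + size S = d]. The threshold [mu ^+ r] is chosen so that at
most [mu] of the possible [x] turn a safe [S] into an unsafe [x :: S]. *)
Definition safe r S i := (count_ext (B i.+1) (poor e (B i) (4 * M)) r S)%:R < mu ^+ r.

(** The last clause keeps the vertices still to come embeddable. It leaves out level [l], where no
    vertex has upper neighbours and the chain ends. *)
Definition partial_embedding s (f : {ffun V -> T}) :=
  [&& uniq (map f s),
      [forall u in s, forall v in s, H u v ==> e (f u) (f v)]
    & [forall v, (v \notin s) && (lev v < l)%N ==>
        safe (d - size (upper_nbrs s v)) (map f (upper_nbrs s v)) (lev v)]].

Lemma chain_sub i j : (i <= j <= l)%N -> B j \subset B i.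
Proof.
case/andP; elim: j => [|j IH]; first by rewrite leqn0 => /eqP ->.
rewrite leq_eqVlt => /predU1P[-> //|ij jl].
by apply: subset_trans (IH ij (ltnW jl)); have [] := chB.2 _ jl.
Qed.

Lemma mu_gt0 : 0 < mu.
Proof. by rewrite /mu divr_gt0 ?ltr0n ?muln_gt0 // mulr_gt0 // ltr0n. Qed.

Lemma mu_lt : mu < 4 * M.
Proof.
rewrite /mu ltr_pdivrMr ?ltr0n ?muln_gt0 // ltr_pMr ?mulr_gt0 // ltr1n.
by rewrite leq_pmulr.
Qed.

Lemma size_upper_nbrs s v : uniq s -> (size (upper_nbrs s v) <= d)%N.
Proof.
move=> us; apply: leq_trans (degH v); rewrite -(card_uniqP _) ?filter_uniq //.
by apply/subset_leq_card/subsetP => u; rewrite mem_filter inE => /andP[/andP[]].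
Qed.

(** By safety the images of the upper neighbours extend to a tuple that is not poor, and lengthening
    a tuple only shrinks its common neighbourhood. At level [l] the candidates are all of [B l]. *)
Lemma card_candidates s f v : v \notin s -> partial_embedding s f ->
  4 * M <= #|common_nbhd e (B (lev v)) (map f (upper_nbrs s v))|%:R.
Proof.
move=> vs /and3P[_ _ /forallP/(_ v)]; rewrite vs /=.
have := lev_le v; rewrite leq_eqVlt => /predU1P[levv _|lt_l].
  have -> : upper_nbrs s v = [::].
    apply/eqP; rewrite -[_ == _]negbK -has_filter; apply/hasPn => u _.
    by rewrite levv ltnNge lev_le andbF.
  suff -> : common_nbhd e (B (lev v)) (map f [::]) = B (lev v) by exact: chB.1.
  by apply/setP => x; rewrite inE andbT.
rewrite lt_l => /= safe_v.
have [] := @light_ext_exists _ _ (B (lev v).+1) _ _ _ _ mu_gt0 _ safe_v.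
  by apply: lt_le_trans mu_lt _; exact: chB.1.
move=> S'; rewrite /poor -leNgt => /le_trans; apply.
by rewrite ler_nat subset_leq_card // common_nbhd_cat.
Qed.

Definition unsafe_for (f : {ffun V -> T}) s v :=
  [set x in B (lev v).+1 |
    ~~ safe (d - (size (upper_nbrs s v)).+1) (x :: map f (upper_nbrs s v)) (lev v)].

Lemma card_unsafe f s v w : uniq (v :: s) -> partial_embedding s f ->
  w \notin v :: s -> H w v -> (lev w < lev v)%N -> #|unsafe_for f s w|%:R <= mu.
Proof.
move=> uvs /and3P[_ _ /forallP/(_ w)] safe_w; rewrite inE negb_or => /andP[wv ws] Hwv lt_wv.
(* The new vertex [v] is itself an upper neighbour of [w], so there is still room for it among the
   [d] entries. *)
have szle : (size (upper_nbrs s w) < d)%N.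
  by have := size_upper_nbrs w uvs; rewrite /upper_nbrs /= Hwv lt_wv.
move: safe_w; rewrite ws (leq_trans lt_wv) //= /safe -subnSK // => safe_w.
rewrite (_ : unsafe_for f s w = [set x in B (lev w).+1 | mu ^+ (d - (size (upper_nbrs s w)).+1)
  <= (count_ext (B (lev w).+1) (poor e (B (lev w)) (4 * M))
     (d - (size (upper_nbrs s w)).+1) (x :: map f (upper_nbrs s w)))%:R]).
  by apply: card_heavy_ext => //; exact: mu_gt0.
by apply/setP => x; rewrite !inE /safe -leNgt.
Qed.

Lemma partial_embedding_extend v s f :
  uniq (v :: s) -> {in s, forall u, (lev v <= lev u)%N} -> partial_embedding s f ->
  M <= #|[set x | partial_embedding (v :: s) (upd f v x)]|%:R.
Proof.
move=> uvs le_lev Pf; have /andP[vs us] := uvs.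
pose W := [set w | [&& H v w, w \notin v :: s & (lev w < lev v)%N]].
pose C := common_nbhd e (B (lev v)) (map f (upper_nbrs s v)).
pose used := [set x in map f s].
pose danger := \bigcup_(w in W) unsafe_for f s w.
have leC : 4 * M <= #|C|%:R by exact: card_candidates.
have le_used : #|used|%:R <= M.
  apply: le_trans M_ge; rewrite ler_nat cardsE; apply: leq_trans (card_size _) _.
  by rewrite size_map -(card_uniqP us) max_card.
have le_danger : #|danger|%:R <= 2 * M.
  have dR : d%:R != 0 :> R by rewrite pnatr_eq0 -lt0n.
  (* At most [d] later neighbours, each forbidding at most [mu] points. *)
  have -> : 2 * M = d%:R * mu by rewrite /mu natrM; field.
  apply: (@le_trans _ _ (\sum_(w in W) #|unsafe_for f s w|%:R)).
    by rewrite -natr_sum ler_nat card_bigcup_le.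
  apply: (@le_trans _ _ (\sum_(w in W) mu)).
    apply: ler_sum => w; rewrite inE => /and3P[Hvw wvs lt_wv].
    by apply: card_unsafe uvs Pf wvs _ lt_wv; rewrite adj_sym.
  rewrite sumr_const -[mu *+ _]mulr_natl ler_pM2r ?mu_gt0 // ler_nat.
  apply: leq_trans (degH v); apply/subset_leq_card/subsetP => w.
  by rewrite !inE => /and3P[].
have : (#|C| <= #|C :\: (used :|: danger)| + (#|used| + #|danger|))%N.
  rewrite -(cardsID (used :|: danger) C) addnC leq_add2l.
  apply: leq_trans (leq_card_setU _ _).1; exact/subset_leq_card/subsetIr.
rewrite -(ler_nat R) !natrD => leCX.
apply: (@le_trans _ _ #|C :\: (used :|: danger)|%:R); first lra.
rewrite ler_nat; apply/subset_leq_card/subsetP => x; rewrite !inE negb_or.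
case/and3P => /andP[x_new x_safe] xB /allP xC.
have map_upd : forall s', {subset s' <= s} -> map (upd f v x) s' = map f s'.
  by move=> s' sub; apply/eq_in_map => u /sub; exact: upd_out.
have updv : upd f v x v = x by rewrite ffunE eqxx.
have /and3P[uf /'forall_in_'forall_in_implyP ef /forallP sf] := Pf.
(* Vertices of [s] lie at least as high as [v], and neighbours never share a level, so every
   embedded neighbour of [v] is an upper one. *)
have ex u : u \in s -> H v u -> e (f u) x.
  move=> u_s Hvu; apply: xC; apply: map_f; rewrite mem_filter Hvu u_s andbT /=.
  by rewrite ltn_neqAle lev_proper // le_lev.
apply/and3P; split.
- by rewrite /= updv map_upd // uf x_new.
- apply/'forall_in_'forall_in_implyP => u u_in w w_in Huw.
  move: u_in w_in; rewrite !inE => /predU1P[uv|u_s] /predU1P[wv|w_s].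
  + by move: Huw; rewrite uv wv adj_irr.
  + by rewrite uv updv (upd_out _ _ vs) // e_sym ex // -uv.
  + by rewrite wv updv (upd_out _ _ vs) // ex // -wv adj_sym.
  + by rewrite !(upd_out _ _ vs) // ef.
- apply/forallP => w; apply/implyP => /andP[wvs lt_l].
  have ws : w \notin s by move: wvs; rewrite inE negb_or => /andP[].
  have sub : {subset upper_nbrs s w <= s} by move=> u; rewrite mem_filter => /andP[].
  rewrite {1 2}/upper_nbrs /= -/(upper_nbrs s w).
  case: ifP => [/andP[Hwv lt_wv]|_]; last first.
    by rewrite map_upd //; have := sf w; rewrite ws lt_l.
  rewrite /= updv map_upd //.
  apply: contraNT x_safe => x_unsafe; apply/bigcupP; exists w.
    by rewrite inE adj_sym Hwv wvs.
  (* [unsafe_for] only collects points of [B (lev w).+1], and this set contains [B (lev v)] because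
     [lev w < lev v]. *)
  rewrite inE x_unsafe andbT; apply: subsetP xB; apply: chain_sub.
  by rewrite lt_wv lev_le.
Qed.

Lemma card_embeddings : M ^+ #|V| <=
  #|[set f : {ffun V -> T} | injectiveb f &
     [forall u, forall v, H u v ==> e (f u) (f v)]]|%:R.
Proof.
have [x0 _] : exists x0, x0 \in B 0%N.
  apply/card_gt0P; rewrite -(ltr0n R); apply: lt_le_trans (chB.1 _ (leq0n l)).
  by rewrite mulr_gt0 // ltr0n.
pose leq_lev u v := (lev u <= lev v)%N.
have lev_trans : transitive leq_lev by move=> u v w; exact: leq_trans.
pose ok s := uniq s && sorted leq_lev s.
(* [card_extensions] treats the tail before the head, so the ascending order embeds the highest
   level first. *)
pose s := sort leq_lev (enum V).
have oks : ok s.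
  by rewrite /ok sort_uniq enum_uniq sort_sorted // => u v; exact: leq_total.
have mem_s u : u \in s by rewrite mem_sort mem_enum.
rewrite (_ : #|V| = size s); last by rewrite size_sort cardE.
have := @card_extensions V T R x0 M partial_embedding ok (ltW M_gt0).
move=> /(_ _ _ _ s oks)/le_trans; apply.
- apply/and3P; split=> //; first by apply/forallP => u; rewrite in_nil.
  apply/forallP => v; apply/implyP => /andP[_ lt_l].
  (* With nothing embedded, safety is exactly the bound on poor tuples in the chain. *)
  by rewrite /= subn0; have [] := chB.2 _ lt_l.
- move=> v s' /andP[/andP[vs us] ss]; split=> //; rewrite /ok.
  by apply/andP; split=> //; exact: path_sorted ss.
- move=> v s' f /andP[uvs ss] Pf; apply: partial_embedding_extend => //.
  exact/allP/(order_path_min lev_trans).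
rewrite ler_nat; apply/subset_leq_card/subsetP => f; rewrite !inE.
case/and3P => uf /'forall_in_'forall_in_implyP ef _; apply/andP; split.
  rewrite /injectiveb /dinjectiveb -(@perm_uniq _ (map f s)) //.
  by apply: perm_map; rewrite perm_sort.
by apply/'forall_'forall_implyP => u v; exact: ef.
Qed.

End GreedyEmbedding.

(** * Choice of the parameters and conclusion *)

Theorem theorem4p1 (V : finType) (H : simple_graph V) (n q d N : nat)
    (c : edge_2coloring N) :
  #|V| = n -> chromatic_number H = q -> max_degree H = d -> (2 <= d)%N ->
  (2 ^ ((2 * d + 2) * (2 * q - 3) + 2) * n <= N)%N ->
  ((2 : rat) ^- ((2 * d + 2) * (2 * q - 3) + 2) * N%:R) ^+ n
    <= #|mono_copies H c|%:R.
Proof.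
move=> cardV chrH maxH d2 leN.
have d0 : (0 < d)%N by apply: leq_trans d2.
have degH v : (degree H v <= d)%N by rewrite -maxH; apply: leq_bigmax.
(* On an empty vertex set the maximum degree would be 0. A vertex gives [0 < q] and [0 < M]. *)
have [v0 _] : exists v : V, true.
  have [/card_gt0P[v _]|] := boolP (0 < #|V|)%N; first by exists v.
  rewrite -eqn0Ngt => /eqP/card0_eq V0; move: d2; rewrite -maxH /max_degree.
  by rewrite big_pred0 // => v; rewrite -(V0 v).
have [lev /forallP lev_proper] : exists f : {ffun V -> 'I_q},
    [forall x, forall y, H x y ==> (f x != f y)].
  by rewrite -chrH /chromatic_number; case: ex_minnP => k /existsP.
have q0 : (0 < q)%N by apply: leq_ltn_trans (ltn_ord (lev v0)).
set E := ((2 * d + 2) * (2 * q - 3))%N in leN *.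
set M : rat := _ * N%:R.
have M_ge : #|V|%:R <= M.
  by rewrite cardV /M mulrC ler_pdivlMr ?exprn_gt0 // mulrC -natrX -natrM ler_nat.
have M_gt0 : 0 < M.
  by apply: lt_le_trans M_ge; rewrite ltr0n; apply/card_gt0P; exists v0.
(* Demanding [q.-1] steps of either color costs [2 * q - 3] steps in all, and the factor 4 absorbs
   the [+ 2] in the exponent. *)
have leN' : (2 ^+ (2 * d + 2)) ^+ (q.-1 + q.-1).-1 * (4 * M) <= #|[set: 'I_N]|%:R.
  rewrite cardsT card_ord -exprM (_ : _ * _ = E)%N; last by rewrite /E; congr muln; lia.
  rewrite le_eqVlt /M exprD; apply/orP; left; apply/eqP; field.
  by rewrite expf_neq0.
have m0 : 0 < 4 * M by rewrite mulr_gt0.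
have [b [B [_ chB]]] := monochromatic_chain d0 m0 c leN'.
have {}chB : rich_chain d (4 * M) (fun x y => c x y == b) q.-1 B by case: b chB.
rewrite -cardV; apply: le_trans (card_embeddings (e := fun x y => c x y == b)
  (lev := fun v => lev v) _ d0 M_gt0 M_ge degH chB _ _) _.
- by move=> x y; rewrite color_sym.
- by move=> v; rewrite -ltnS prednK.
- by move=> u v Huv; have /forallP/(_ v)/implyP/(_ Huv) := lev_proper u.
rewrite ler_nat; apply/subset_leq_card/subsetP => f; rewrite !inE => /andP[-> mono].
by apply/existsP; exists b.
Qed.
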